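(* Consider the semi-discrete nodal DG scheme described in the context below for the two-dimensional ideal MHD equations on $\Omega=[a,b]\times[c,d]$, with entropy conservative volume fluxes $\mathbf F^S,\mathbf G^S$ and entropy stable interface fluxes $\hat{\mathbf F},\hat{\mathbf G}$ (as defined in the context). Assume that the boundary conditions are periodic, compactly supported, or reflective. If the nodal magnetic field of $\mathbf U_h$ is globally divergence-free, i.e. for all $i,j,i_1,j_1$ $$\sum_{l=0}^{k+1}\Big(\frac{2}{\Delta x}D_{i_1,l}B^{i,j}_{x,l,j_1}+\frac{2}{\Delta y}D_{j_1,l}B^{i,j}_{y,i_1,l}\Big)=0,$$ $$B^{i,j}_{x,k+1,j_1}=B^{i+1,j}_{x,0,j_1}=:B^{i+1/2,j}_{x,j_1},\qquad B^{i,j}_{y,i_1,k+1}=B^{i,j+1}_{y,i_1,0}=:B^{i,j+1/2}_{y,i_1},$$ then the scheme is entropy conservative within each single element $K_{ij}$: $$\frac{\mathrm d}{\mathrm dt}\Big(\frac{\Delta x\Delta y}{4}\sum_{i_1,j_1=0}^{k+1}\omega_{i_1}\omega_{j_1}\mathcal U^{i,j}_{i_1,j_1}\Big)=-\sum_{j_1=0}^{k+1}\frac{\Delta y}{2}\omega_{j_1}\big(\mathcal F^{*,i,j}_{k+1,j_1}-\mathcal F^{*,i,j}_{0,j_1}\big)-\sum_{i_1=0}^{k+1}\frac{\Delta x}{2}\omega_{i_1}\big(\mathcal G^{*,i,j}_{i_1,k+1}-\mathcal G^{*,i,j}_{i_1,0}\big),$$ where $\mathcal F^{*,i,j}_{k+1,j_1}=(\mathbf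 V^{i,j}_{k+1,j_1})^T\mathbf F^{*,i,j}_{k+1,j_1}-\psi^{i,j}_{F,k+1,j_1}+\phi^{i,j}_{k+1,j_1}B^{i+1/2,j}_{x,j_1}$, $\mathcal F^{*,i,j}_{0,j_1}=(\mathbf V^{i,j}_{0,j_1})^T\mathbf F^{*,i,j}_{0,j_1}-\psi^{i,j}_{F,0,j_1}+\phi^{i,j}_{0,j_1}B^{i-1/2,j}_{x,j_1}$, $\mathcal G^{*,i,j}_{i_1,k+1}=(\mathbf V^{i,j}_{i_1,k+1})^T\mathbf G^{*,i,j}_{i_1,k+1}-\psi^{i,j}_{G,i_1,k+1}+\phi^{i,j}_{i_1,k+1}B^{i,j+1/2}_{y,i_1}$, $\mathcal G^{*,i,j}_{i_1,0}=(\mathbf V^{i,j}_{i_1,0})^T\mathbf G^{*,i,j}_{i_1,0}-\psi^{i,j}_{G,i_1,0}+\phi^{i,j}_{i_1,0}B^{i,j-1/2}_{y,i_1}$; and the scheme is entropy stable on the whole domain in the sense that $$\frac{\mathrm d}{\mathrm dt}\Big(\frac{\Delta x\Delta y}{4}\sum_{i,j=1}^{N_x,N_y}\sum_{i_1,j_1=0}^{k+1}\omega_{i_1}\omega_{j_1}\mathcal U^{i,j}_{i_1,j_1}\Big)\le 0$$ (the left-hand side being a quadrature approximation of $\frac{\mathrm d}{\mathrm dt}\int_\Omega\mathcal U(\mathbf U_h)\,\mathrm dx\,\mathrm dy$).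
   Context: Ideal MHD: conserved variables $\mathbf U=(\rho,\rho u_x,\rho u_y,\rho u_z,\mathcal E,B_x,B_y,B_z)^T$, with $\mathcal E=\frac{p}{\gamma-1}+\frac12\rho\|\mathbf u\|^2+\frac12\|\mathbf B\|^2$, total pressure $p^\star=p+\frac12\|\mathbf B\|^2$, system $\partial_t\mathbf U+\partial_x\mathbf F(\mathbf U)+\partial_y\mathbf G(\mathbf U)=0$ with $\mathbf F=(\rho u_x,\ \rho u_x^2+p^\star-B_x^2,\ \rho u_xu_y-B_xB_y,\ \rho u_xu_z-B_xB_z,\ u_x(\mathcal E+p^\star)-B_x(\mathbf u\cdot\mathbf B),\ 0,\ u_xB_y-u_yB_x,\ u_xB_z-u_zB_x)^T$, $\mathbf G=(\rho u_y,\ \rho u_xu_y-B_xB_y,\ \rho u_y^2+p^\star-B_y^2,\ \rho u_yu_z-B_yB_z,\ u_y(\mathcal E+p^\star)-B_y(\mathbf u\cdot\mathbf B),\ u_yB_x-u_xB_y,\ 0,\ u_yB_z-u_zB_y)^T$. Entropy quantities: $s=\ln(p\rho^{-\gamma})$, $\mathcal U=-\rho s/(\gamma-1)$, entropy fluxes $\mathcal F=-\rho u_xs/(\gamma-1)$, $\mathcal G=-\rho u_ys/(\gamma-1)$; $\beta=\rho/(2p)$; entropy variables $\mathbf V=\big(\frac{\gamma-s}{\gamma-1}-\beta\|\mathbf u\|^2,\ 2\beta\mathbf u,\ -2\beta,\ 2\beta\mathbf B\big)^T$; potentials $\psi_F=\mathbf V^T\mathbf F(\mathbf U)-\mathcal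 F(\mathbf U)$, $\psi_G=\mathbf V^T\mathbf G(\mathbf U)-\mathcal G(\mathbf U)$, and $\phi=2\beta(\mathbf u\cdot\mathbf B)$. A superscript/subscript on $\mathcal U,\mathbf V,\psi_F,\psi_G,\phi,\mathbf F,\mathbf G$ means evaluation at the corresponding nodal value of $\mathbf U_h$. Discretization: $\Omega$ is divided into a uniform $N_x\times N_y$ rectangular mesh with cells $K_{ij}=[x_{i-1/2},x_{i+1/2}]\times[y_{j-1/2},y_{j+1/2}]$, sizes $\Delta x,\Delta y$, centers $(x_i,y_j)$. Let $-1=X_0<\dots<X_{k+1}=1$ be the $k+2$ Gauss–Lobatto points on $[-1,1]$ with weights $\omega_l$, $L_l$ the Lagrange basis polynomials with $L_l(X_j)=\delta_{lj}$, $D_{jl}=L_l'(X_j)$, $\tau_0=-1$, $\tau_{k+1}=1$, $\tau_l=0$ otherwise. $\mathbf U_h$ is piecewise in $Q^{k+1}$ (tensor-product polynomials of degree $\le k+1$) with nodal values $\mathbf U^{i,j}_{i_1,j_1}=\mathbf U_h(x_i+\frac{\Delta x}{2}X_{i_1},\,y_j+\frac{\Delta y}{2}X_{j_1})$, $0\le i_1,j_1\le k+1$. Interface flux values: $\mathbf F^{*,i,j}_{0,j_1}=\hat{\mathbf F}(\mathbf U^{i-1,j}_{k+1,j_1},\mathbf U^{i,j}_{0,j_1})$, $\mathbf F^{*,i,j}_{k+1,j_1}=\hat{\mathbf F}(\mathbf U^{i,j}_{k+1,j_1},\mathbf U^{i+1,j}_{0,j_1})$, $\mathbf F^{*,i,j}_{i_1,j_1}=\mathbf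 0$ for $1\le i_1\le k$; similarly $\mathbf G^{*,i,j}_{i_1,0}=\hat{\mathbf G}(\mathbf U^{i,j-1}_{i_1,k+1},\mathbf U^{i,j}_{i_1,0})$, $\mathbf G^{*,i,j}_{i_1,k+1}=\hat{\mathbf G}(\mathbf U^{i,j}_{i_1,k+1},\mathbf U^{i,j+1}_{i_1,0})$, zero otherwise; neighbor states outside $\Omega$ are supplied by the boundary condition. The semi-discrete scheme is, for all $i,j$ and $0\le i_1,j_1\le k+1$, $$\frac{\mathrm d\mathbf U^{i,j}_{i_1,j_1}}{\mathrm dt}=-\frac{2}{\Delta x}\sum_{l=0}^{k+1}2D_{i_1,l}\mathbf F^S(\mathbf U^{i,j}_{i_1,j_1},\mathbf U^{i,j}_{l,j_1})+\frac{2}{\Delta x}\frac{\tau_{i_1}}{\omega_{i_1}}(\mathbf F^{i,j}_{i_1,j_1}-\mathbf F^{*,i,j}_{i_1,j_1})-\frac{2}{\Delta y}\sum_{l=0}^{k+1}2D_{j_1,l}\mathbf G^S(\mathbf U^{i,j}_{i_1,j_1},\mathbf U^{i,j}_{i_1,l})+\frac{2}{\Delta y}\frac{\tau_{j_1}}{\omega_{j_1}}(\mathbf G^{i,j}_{i_1,j_1}-\mathbf G^{*,i,j}_{i_1,j_1}).$$ Fluxes: $\mathbf F^S(\mathbf U_L,\mathbf U_R)$ is a consistent symmetric two-point flux that is entropy conservative: $(\mathbf V_R-\mathbf V_L)^T\mathbf F^S(\mathbf U_L,\mathbf U_R)=(\psi_{F,R}-\psi_{F,L})-(\phi_R-\phi_L)\frac{B_{x,R}+B_{x,L}}{2}$;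 $\hat{\mathbf F}$ is a consistent two-point flux that is entropy stable: $(\mathbf V_R-\mathbf V_L)^T\hat{\mathbf F}(\mathbf U_L,\mathbf U_R)\le(\psi_{F,R}-\psi_{F,L})-(\phi_R-\phi_L)\frac{B_{x,R}+B_{x,L}}{2}$. $\mathbf G^S$ and $\hat{\mathbf G}$ satisfy the analogous relations with $\psi_G$ and $B_y$ in place of $\psi_F$ and $B_x$. (In the paper, the interface flux is an HLL flux with wave-speed estimates making it entropy stable; a reflective wall is imposed through a mirrored ghost state $(\rho,-u_x,u_y,u_z,\mathcal E,-B_x,B_y,B_z)$ for a wall normal to $x$, and analogously in $y$.)
   Formalization: For reflective boundaries the interface flux in that direction is additionally assumed mirror-invariant (as HLL with symmetric wave speeds is); for an arbitrary entropy stable flux the global inequality can fail at a reflective wall. *)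

(* Defs.v *)
From HB Require Import structures.
From mathcomp Require Import all_boot all_order all_algebra.
From mathcomp Require Import all_classical all_reals all_analysis.
Set Implicit Arguments. Unset Strict Implicit. Unset Printing Implicit Defensive.
Import Order.TTheory GRing.Theory Num.Theory.
Import numFieldNormedType.Exports.
Local Open Scope ring_scope.

Section MHD.
Variable R : realType.

(* A state vector U = (rho, rho ux, rho uy, rho uz, E, Bx, By, Bz). *)
Definition state := 'I_8 -> R.

Definition mkstate (a0 a1 a2 a3 a4 a5 a6 a7 : R) : state :=
  fun c => nth 0 [:: a0; a1; a2; a3; a4; a5; a6; a7] (nat_of_ord c).

Definition comp (n : nat) (U : state) : R := match n with
  | 0 => U (@Ordinal 8 0 erefl) | 1 => U (@Ordinal 8 1 erefl)
  | 2 => U (@Ordinal 8 2 erefl) | 3 => U (@Ordinal 8 3 erefl)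
  | 4 => U (@Ordinal 8 4 erefl) | 5 => U (@Ordinal 8 5 erefl)
  | 6 => U (@Ordinal 8 6 erefl) | _ => U (@Ordinal 8 7 erefl) end.

Definition rho U := comp 0 U.
Definition ux U := comp 1 U / rho U.
Definition uy U := comp 2 U / rho U.
Definition uz U := comp 3 U / rho U.
Definition Etot U := comp 4 U.
Definition Bx U := comp 5 U.
Definition By U := comp 6 U.
Definition Bz U := comp 7 U.
Definition usq U := ux U ^+ 2 + uy U ^+ 2 + uz U ^+ 2.
Definition Bsq U := Bx U ^+ 2 + By U ^+ 2 + Bz U ^+ 2.
Definition udotB U := ux U * Bx U + uy U * By U + uz U * Bz U.

Variable gamma : R.

(* p from E = p/(gamma-1) + rho|u|^2/2 + |B|^2/2 *)
Definition pres U := (gamma - 1) * (Etot U - rho U * usq U / 2 - Bsq U / 2).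
Definition pstar U := pres U + Bsq U / 2.

Definition admissible U := 0 < rho U /\ 0 < pres U.

Definition Fx U : state := mkstate
  (rho U * ux U)
  (rho U * ux U ^+ 2 + pstar U - Bx U ^+ 2)
  (rho U * ux U * uy U - Bx U * By U)
  (rho U * ux U * uz U - Bx U * Bz U)
  (ux U * (Etot U + pstar U) - Bx U * udotB U)
  0
  (ux U * By U - uy U * Bx U)
  (ux U * Bz U - uz U * Bx U).

Definition Gy U : state := mkstate
  (rho U * uy U)
  (rho U * ux U * uy U - Bx U * By U)
  (rho U * uy U ^+ 2 + pstar U - By U ^+ 2)
  (rho U * uy U * uz U - By U * Bz U)
  (uy U * (Etot U + pstar U) - By U * udotB U)
  (uy U * Bx U - ux U * By U)
  0
  (uy U * Bz U - uz U * By U).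

Definition sent U := ln (pres U * (rho U) `^ (- gamma)).
Definition Uent U := - rho U * sent U / (gamma - 1).
Definition Fent U := - rho U * ux U * sent U / (gamma - 1).
Definition Gent U := - rho U * uy U * sent U / (gamma - 1).
Definition beta U := rho U / (2 * pres U).
Definition Vent U : state := mkstate
  ((gamma - sent U) / (gamma - 1) - beta U * usq U)
  (2 * beta U * ux U) (2 * beta U * uy U) (2 * beta U * uz U)
  (- 2 * beta U)
  (2 * beta U * Bx U) (2 * beta U * By U) (2 * beta U * Bz U).

Definition dot (a b : state) : R := \sum_(c < 8) a c * b c.

Definition psiF U := dot (Vent U) (Fx U) - Fent U.
Definition psiG U := dot (Vent U) (Gy U) - Gent U.
Definition phi U := 2 * beta U * udotB U.

Definition mirror_x U : state := mkstate (rho U) (- comp 1 U) (comp 2 U) (comp 3 U)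
  (Etot U) (- Bx U) (By U) (Bz U).
Definition mirror_y U : state := mkstate (rho U) (comp 1 U) (- comp 2 U) (comp 3 U)
  (Etot U) (Bx U) (- By U) (Bz U).

Definition ec_flux_x (FS : state -> state -> state) :=
  [/\ (forall U, admissible U -> FS U U = Fx U),
      (forall UL UR, admissible UL -> admissible UR -> FS UL UR = FS UR UL) &
      (forall UL UR, admissible UL -> admissible UR ->
        \sum_(c < 8) (Vent UR c - Vent UL c) * FS UL UR c
        = (psiF UR - psiF UL) - (phi UR - phi UL) * ((Bx UR + Bx UL) / 2))].

Definition ec_flux_y (GS : state -> state -> state) :=
  [/\ (forall U, admissible U -> GS U U = Gy U),
      (forall UL UR, admissible UL -> admissible UR -> GS UL UR = GS UR UL) &
      (forall UL UR, admissible UL -> admissible UR ->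
        \sum_(c < 8) (Vent UR c - Vent UL c) * GS UL UR c
        = (psiG UR - psiG UL) - (phi UR - phi UL) * ((By UR + By UL) / 2))].

Definition es_flux_x (Fh : state -> state -> state) :=
  (forall U, admissible U -> Fh U U = Fx U) /\
  (forall UL UR, admissible UL -> admissible UR ->
     \sum_(c < 8) (Vent UR c - Vent UL c) * Fh UL UR c
     <= (psiF UR - psiF UL) - (phi UR - phi UL) * ((Bx UR + Bx UL) / 2)).

Definition es_flux_y (Gh : state -> state -> state) :=
  (forall U, admissible U -> Gh U U = Gy U) /\
  (forall UL UR, admissible UL -> admissible UR ->
     \sum_(c < 8) (Vent UR c - Vent UL c) * Gh UL UR c
     <= (psiG UR - psiG UL) - (phi UR - phi UL) * ((By UR + By UL) / 2)).

(* mirror (reflection) invariance of a numerical flux: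
   Fh(M UR, M UL) = - M Fh(UL, UR)  (satisfied by the HLL flux with
   mirror-symmetric wave-speed estimates); only required for reflective walls *)
Definition mirror_invariant_x (Fh : state -> state -> state) :=
  forall UL UR, admissible UL -> admissible UR ->
    forall c, Fh (mirror_x UR) (mirror_x UL) c = - mirror_x (Fh UL UR) c.
Definition mirror_invariant_y (Gh : state -> state -> state) :=
  forall UL UR, admissible UL -> admissible UR ->
    forall c, Gh (mirror_y UR) (mirror_y UL) c = - mirror_y (Gh UL UR) c.

(* X_0 < ... < X_{k+1}, X_0 = -1, X_{k+1} = 1, and the quadrature with weights
   w is exact for all polynomials of degree <= 2k+1 (checked on monomials;
   (1 - (-1)^(m+1))/(m+1) = \int_{-1}^1 x^m dx).  This is the (k+2)-point
   Gauss-Lobatto rule. *)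
Definition gauss_lobatto (k : nat) (X w : nat -> R) :=
  [/\ X 0%N = -1, X k.+1 = 1,
      (forall i, (i < k.+1)%N -> X i < X i.+1) &
      (forall m, (m <= 2 * k + 1)%N ->
         \sum_(l < k.+2) w l * X l ^+ m = (1 - (-1) ^+ m.+1) / m.+1%:R)].

Definition lagrange (k : nat) (X : nat -> R) (l : nat) : {poly R} :=
  \prod_(m < k.+2 | (m : nat) != l) (('X - (X m)%:P) * ((X l - X m)^-1)%:P).

Definition Dmat (k : nat) (X : nat -> R) (j l : nat) : R :=
  ((lagrange k X l)^`()).[X j].

Definition tau (k : nat) (i : nat) : R :=
  if i == 0%N then -1 else if i == k.+1 then 1 else 0.

(* W i j i1 j1 = nodal value U^{i,j}_{i1,j1}; cells 0 <= i < Nx, 0 <= j < Ny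
   (0-based cell indices), nodes 0 <= i1, j1 <= k+1. *)
Definition meshfun := nat -> nat -> nat -> nat -> state.

Inductive bc := Periodic | Reflective | Compact of state.

Definition nbL (k Nx : nat) (bx : bc) (W : meshfun) i j j1 : state :=
  if i == 0%N then
    match bx with
    | Periodic => W Nx.-1 j k.+1 j1
    | Reflective => mirror_x (W 0%N j 0%N j1)
    | Compact Ub => Ub end
  else W i.-1 j k.+1 j1.

Definition nbR (k Nx : nat) (bx : bc) (W : meshfun) i j j1 : state :=
  if i == Nx.-1 then
    match bx with
    | Periodic => W 0%N j 0%N j1
    | Reflective => mirror_x (W i j k.+1 j1)
    | Compact Ub => Ub end
  else W i.+1 j 0%N j1.

Definition nbB (k Ny : nat) (by_ : bc) (W : meshfun) i j i1 : state :=
  if j == 0%N then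
    match by_ with
    | Periodic => W i Ny.-1 i1 k.+1
    | Reflective => mirror_y (W i 0%N i1 0%N)
    | Compact Ub => Ub end
  else W i j.-1 i1 k.+1.

Definition nbT (k Ny : nat) (by_ : bc) (W : meshfun) i j i1 : state :=
  if j == Ny.-1 then
    match by_ with
    | Periodic => W i 0%N i1 0%N
    | Reflective => mirror_y (W i j i1 k.+1)
    | Compact Ub => Ub end
  else W i j.+1 i1 0%N.

(* compactly supported: U_h equals the constant background state on the
   boundary faces (and the ghost state is that constant state) *)
Definition bc_compat (k Nx Ny : nat) (bx by_ : bc) (W : meshfun) :=
  (forall Ub, bx = Compact Ub -> forall j j1, (j < Ny)%N -> (j1 < k.+2)%N ->
      W 0%N j 0%N j1 = Ub /\ W Nx.-1 j k.+1 j1 = Ub) /\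
  (forall Ub, by_ = Compact Ub -> forall i i1, (i < Nx)%N -> (i1 < k.+2)%N ->
      W i 0%N i1 0%N = Ub /\ W i Ny.-1 i1 k.+1 = Ub).

Section Scheme.
Variables (k Nx Ny : nat) (bx by_ : bc) (X w : nat -> R) (dx dy : R).
Variables (FS GS Fh Gh : state -> state -> state).

Definition Fstar (W : meshfun) i j i1 j1 : state :=
  if i1 == 0%N then Fh (nbL k Nx bx W i j j1) (W i j 0%N j1)
  else if i1 == k.+1 then Fh (W i j k.+1 j1) (nbR k Nx bx W i j j1)
  else (fun _ => 0).

Definition Gstar (W : meshfun) i j i1 j1 : state :=
  if j1 == 0%N then Gh (nbB k Ny by_ W i j i1) (W i j i1 0%N)
  else if j1 == k.+1 then Gh (W i j i1 k.+1) (nbT k Ny by_ W i j i1)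
  else (fun _ => 0).

Definition rhs (W : meshfun) i j i1 j1 : state := fun c =>
  - (2 / dx) * (\sum_(l < k.+2) 2 * Dmat k X i1 l * FS (W i j i1 j1) (W i j l j1) c)
  + (2 / dx) * (tau k i1 / w i1) * (Fx (W i j i1 j1) c - Fstar W i j i1 j1 c)
  - (2 / dy) * (\sum_(l < k.+2) 2 * Dmat k X j1 l * GS (W i j i1 j1) (W i j i1 l) c)
  + (2 / dy) * (tau k j1 / w j1) * (Gy (W i j i1 j1) c - Gstar W i j i1 j1 c).

Definition divfree (W : meshfun) :=
  [/\ (forall i j i1 j1, (i < Nx)%N -> (j < Ny)%N -> (i1 < k.+2)%N -> (j1 < k.+2)%N ->
        \sum_(l < k.+2) (2 / dx * Dmat k X i1 l * Bx (W i j l j1)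
                         + 2 / dy * Dmat k X j1 l * By (W i j i1 l)) = 0),
      (forall i j j1, (i < Nx)%N -> (j < Ny)%N -> (j1 < k.+2)%N ->
        Bx (W i j k.+1 j1) = Bx (nbR k Nx bx W i j j1) /\
        Bx (W i j 0%N j1) = Bx (nbL k Nx bx W i j j1)) &
      (forall i j i1, (i < Nx)%N -> (j < Ny)%N -> (i1 < k.+2)%N ->
        By (W i j i1 k.+1) = By (nbT k Ny by_ W i j i1) /\
        By (W i j i1 0%N) = By (nbB k Ny by_ W i j i1))].

(* numerical entropy fluxes at the faces;  B^{i+1/2,j}_{x,j1} := B^{i,j}_{x,k+1,j1},
   B^{i-1/2,j}_{x,j1} := B^{i-1,j}_{x,k+1,j1} (neighbor / ghost value), etc. *)
Definition FentR (W : meshfun) i j j1 : R :=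
  dot (Vent (W i j k.+1 j1)) (Fstar W i j k.+1 j1) - psiF (W i j k.+1 j1)
  + phi (W i j k.+1 j1) * Bx (W i j k.+1 j1).
Definition FentL (W : meshfun) i j j1 : R :=
  dot (Vent (W i j 0%N j1)) (Fstar W i j 0%N j1) - psiF (W i j 0%N j1)
  + phi (W i j 0%N j1) * Bx (nbL k Nx bx W i j j1).
Definition GentT (W : meshfun) i j i1 : R :=
  dot (Vent (W i j i1 k.+1)) (Gstar W i j i1 k.+1) - psiG (W i j i1 k.+1)
  + phi (W i j i1 k.+1) * By (W i j i1 k.+1).
Definition GentB (W : meshfun) i j i1 : R :=
  dot (Vent (W i j i1 0%N)) (Gstar W i j i1 0%N) - psiG (W i j i1 0%N)
  + phi (W i j i1 0%N) * By (nbB k Ny by_ W i j i1).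

Definition cell_entropy (W : meshfun) i j : R :=
  dx * dy / 4 * \sum_(i1 < k.+2) \sum_(j1 < k.+2) w i1 * w j1 * Uent (W i j i1 j1).
Definition total_entropy (W : meshfun) : R :=
  dx * dy / 4 * \sum_(i < Nx) \sum_(j < Ny)
     \sum_(i1 < k.+2) \sum_(j1 < k.+2) w i1 * w j1 * Uent (W i j i1 j1).

End Scheme.
End MHD.

(* Main.v *)
(* Contracting the scheme with the entropy variables V turns the left-hand side into the time
   derivative of the entropy. Along each line of nodes the Gauss-Lobatto derivative matrix has the
   summation-by-parts property w_j D_jl + w_l D_lj = tau_j delta_jl, because L_j' L_l has degree at
   most 2k+1; so the entropy-conservative volume fluxes telescope to the two end points, up to the
   nonconservative terms phi (D B). Summed over both directions these give phi times the discrete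
   divergence of B, which vanishes. Globally, the entropy fluxes seen from the two sides of an
   interface differ with the favourable sign by entropy stability; a wall flux f satisfies
   M f = -f for the mirror map M, so its entropy flux also has the favourable sign. *)

Require Import Defs.
From HB Require Import structures.
From mathcomp Require Import all_boot all_order all_algebra.
From mathcomp Require Import all_classical all_reals all_analysis.
From mathcomp Require Import polyrcf zify ring lra.
Import Order.TTheory GRing.Theory Num.Theory.
Import numFieldNormedType.Exports.
Local Open Scope ring_scope.
Set Implicit Arguments. Unset Strict Implicit. Unset Printing Implicit Defensive.

(** * Gauss-Lobatto quadrature, Lagrange basis and summation by parts *)

Lemma exists_antideriv (R : numFieldType) (p : {poly R}) :
  exists2 P : {poly R}, P^`() = p & (size P <= (size p).+1)%N.
Proof.
exists (\poly_(i < (size p).+1) (p`_i.-1 / i%:R)); last exact: size_poly.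
apply/polyP => i; rewrite coef_deriv coef_poly ltnS.
case: ltnP => [_|lei]; last by rewrite mul0rn nth_default.
by rewrite -[LHS]mulr_natr divfK // pnatr_eq0.
Qed.

Lemma gauss_lobatto_lt (R : realType) k (X w : nat -> R) i j :
  gauss_lobatto k X w -> (i < j)%N -> (j < k.+2)%N -> X i < X j.
Proof.
case=> _ _ mX _; rewrite !ltnS => ltij lejk.
apply: (homo_ltn_in (D := [pred n | n <= k.+1]%N) lt_trans) => //=.
- by move=> a b _ bD c /andP[_ cb]; rewrite inE (leq_trans (ltnW cb)).
- by move=> a _; rewrite inE; apply: mX.
- by rewrite inE (leq_trans (ltnW ltij)).
Qed.

Lemma gauss_lobatto_inj (R : realType) k (X w : nat -> R) i j :
  gauss_lobatto k X w -> (i < k.+2)%N -> (j < k.+2)%N ->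
  (X i == X j) = (i == j).
Proof.
move=> gl hi hj; case: (ltngtP i j) => [ij|ji|->]; last by rewrite eqxx.
  by rewrite lt_eqF // (gauss_lobatto_lt gl).
by rewrite gt_eqF // (gauss_lobatto_lt gl).
Qed.

(** Exactness up to degree 2k+1, phrased as the fundamental theorem of calculus so that no integral
    appears: each monomial of P contributes its own boundary difference. *)
Lemma gauss_lobatto_deriv (R : realType) k (X w : nat -> R) (P : {poly R}) :
  gauss_lobatto k X w -> (size P <= (2 * k).+3)%N ->
  \sum_(l < k.+2) w l * (P^`()).[X l] = P.[1] - P.[-1].
Proof.
move=> gl sP; have [_ _ _ exact_w] := gl.
have sP' : (size P^`() <= (2 * k).+2)%N.
  by apply/leq_sizeP => i hi; rewrite coef_deriv nth_default ?mul0rn // (leq_trans sP).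
under eq_bigr => l _ do rewrite (horner_coef_wide _ sP') mulr_sumr.
rewrite exchange_big /= !(horner_coef_wide _ sP) -sumrB [RHS]big_ord_recl /=.
rewrite !expr0 subrr add0r; apply: eq_bigr => m _.
rewrite coef_deriv /bump leq0n add1n expr1n -mulrBr.
under eq_bigr => l _ do rewrite mulrCA.
rewrite -mulr_sumr exact_w; last by rewrite addn1 -ltnS.
by rewrite -[P`_m.+1 *+ _]mulr_natr mulrAC -mulrA divfK // pnatr_eq0.
Qed.

Lemma lagrange_node (R : realType) k (X w : nat -> R) l j :
  gauss_lobatto k X w -> (l < k.+2)%N -> (j < k.+2)%N ->
  (Defs.lagrange k X l).[X j] = (l == j)%:R.
Proof.
move=> gl hl hj; rewrite /Defs.lagrange horner_prod.
have [<-|neq] := eqVneq l j.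
  apply: big1 => m ml; rewrite !hornerE divff // subr_eq0.
  by rewrite (gauss_lobatto_inj gl) // eq_sym.
by rewrite (bigD1 (Ordinal hj)) 1?eq_sym //= !hornerE subrr !mul0r.
Qed.

Lemma size_lagrange (R : realType) k (X : nat -> R) l : (l < k.+2)%N ->
  (size (Defs.lagrange k X l) <= k.+2)%N.
Proof.
move=> hl; apply: leq_trans (size_poly_prod_leq _ _) _.
have card_l : #|[pred m : 'I_k.+2 | (m : nat) != l]| = k.+1.
  rewrite -[RHS]/(k.+2.-1) -[in RHS](card_ord k.+2) -(cardC1 (Ordinal hl)).
  by apply: eq_card => m; rewrite !inE.
rewrite card_l leq_subLR addnS ltnS.
rewrite (_ : (k.+1 + k.+1)%N = \sum_(m < k.+2 | (m : nat) != l) 2)%N; last first.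
  by rewrite sum_nat_const card_l muln2 addnn.
apply: leq_sum => m _; rewrite mulrC mul_polyC.
by rewrite (leq_trans (size_scale_leq _ _)) // size_XsubC.
Qed.

(** The difference of the two sides has degree at most k+1 and vanishes at the k+2 distinct
    nodes. *)
Lemma sum_lagrange (R : realType) k (X w : nat -> R) :
  gauss_lobatto k X w -> \sum_(l < k.+2) Defs.lagrange k X l = 1.
Proof.
move=> gl; apply/eqP; rewrite -subr_eq0; apply/eqP.
apply: (@roots_geq_poly_eq0 _ _ [seq X i | i <- iota 0 k.+2]).
- apply/allP => x /mapP [i]; rewrite mem_iota => /= hi ->.
  rewrite rootE hornerD hornerN hornerC horner_sum (bigD1 (Ordinal hi)) //=.
  rewrite (lagrange_node gl) // eqxx big1 ?addr0 ?subrr // => m.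
  by rewrite (lagrange_node gl) // -val_eqE /= => /negPf ->.
- rewrite map_inj_in_uniq ?iota_uniq // => i j; rewrite !mem_iota /= => hi hj.
  by move/eqP; rewrite (gauss_lobatto_inj gl) // => /eqP.
- rewrite size_map size_iota (leq_trans (size_polyD _ _)) // geq_max.
  rewrite size_polyN size_poly1 andbT.
  apply: (leq_trans (size_sum _ _ _)); apply/bigmax_leqP => i _.
  exact: size_lagrange.
Qed.

Lemma Dmat_row_sum (R : realType) k (X w : nat -> R) j :
  gauss_lobatto k X w -> \sum_(l < k.+2) Dmat k X j l = 0.
Proof.
move=> gl; transitivity ((\sum_(l < k.+2) Defs.lagrange k X l)^`()).[X j].
  by rewrite raddf_sum horner_sum.
by rewrite (sum_lagrange gl) (derivC 1) horner0.
Qed.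

(** The quadrature is exact on (L_j L_l)'. By the product rule and the nodal values of the basis,
    only the terms at X_j and X_l survive in it. *)
Lemma Dmat_sbp (R : realType) k (X w : nat -> R) j l :
  gauss_lobatto k X w -> (j < k.+2)%N -> (l < k.+2)%N ->
  w j * Dmat k X j l + w l * Dmat k X l j = tau R k j *+ (j == l).
Proof.
move=> gl hj hl; have [X0 X1 _ _] := gl.
have node := lagrange_node gl.
have sJL : (size (Defs.lagrange k X j * Defs.lagrange k X l)%R <= (2 * k).+3)%N.
  apply: leq_trans (size_polyMleq _ _) _.
  have := leq_add (size_lagrange X hj) (size_lagrange X hl).
  by rewrite -subn1 leq_subLR; lia.
have := gauss_lobatto_deriv gl sJL.
rewrite !hornerM -X0 -X1 !node //.
under eq_bigr => m _ do rewrite derivM hornerD !hornerM !node // mulrDr.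
rewrite big_split /= (bigD1 (Ordinal hl)) //= eqxx mulr1 big1 ?addr0; last first.
  by move=> m; rewrite -val_eqE /= eq_sym => /negPf ->; rewrite !mulr0.
rewrite (bigD1 (Ordinal hj)) //= eqxx mul1r big1 ?addr0; last first.
  by move=> m; rewrite -val_eqE /= eq_sym => /negPf ->; rewrite mul0r mulr0.
rewrite addrC /Dmat => ->; rewrite /tau.
(* The boundary difference is now [(j == k.+1) * (l == k.+1) - (j == 0) * (l == 0)], which has to be
   matched with [tau]. *)
have [<-|jl] := eqVneq j l.
  have [->|j0] := eqVneq j 0%N; first by rewrite /= !mulr0 mulr1 sub0r.
  by case: eqVneq; rewrite /= ?mulr0 ?mulr1 subr0.
have [jk|_] := eqVneq j k.+1; have [j0|_] := eqVneq j 0%N;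
  rewrite ?mul0r ?mul1r ?subr0 ?sub0r ?mulr0n.
- by move: jk; rewrite j0.
- by rewrite -jk eq_sym (negPf jl).
- by rewrite -j0 eq_sym (negPf jl) oppr0.
- by [].
Qed.

(** * Positivity of the Gauss-Lobatto weights *)

(* For fixed l, the product over m != l of the nonnegative factors below vanishes at all nodes
   but X l and has degree at most 2k+1: exactness then gives the sign of w l. *)
Definition node_factor (R : realType) k (X : nat -> R) m : {poly R} :=
  if m == 0%N then 'X - (X 0%N)%:P else
  if m == k.+1 then (X k.+1)%:P - 'X else ('X - (X m)%:P) ^+ 2.

Lemma size_node_factor (R : realType) k (X : nat -> R) m :
  size (node_factor k X m) = (if (m == 0) || (m == k.+1) then 2 else 3)%N.
Proof.
rewrite /node_factor; case: eqP => //= _; first by rewrite size_XsubC.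
case: eqP => //= _; first by rewrite -opprB size_polyN size_XsubC.
by rewrite size_exp_XsubC.
Qed.

Lemma node_factor_root (R : realType) k (X : nat -> R) m : (node_factor k X m).[X m] = 0.
Proof.
rewrite /node_factor; case: eqP => [->|_]; first by rewrite !hornerE subrr.
by case: eqP => [->|_]; rewrite !hornerE subrr ?expr0n.
Qed.

Lemma node_factor_gt0 (R : realType) k (X w : nat -> R) m x :
  gauss_lobatto k X w -> -1 <= x <= 1 -> x != X m -> 0 < (node_factor k X m).[x].
Proof.
move=> gl /andP[x0 x1] xm; have [X0 X1 _ _] := gl; rewrite /node_factor.
have [m0|_] := eqVneq m 0%N.
  by rewrite !hornerE subr_gt0 lt_neqAle X0 x0 andbT eq_sym -X0 -m0.
have [mk|_] := eqVneq m k.+1.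
  by rewrite !hornerE subr_gt0 lt_neqAle X1 x1 andbT -X1 -mk.
by rewrite !hornerE exprn_even_gt0 //= subr_eq0.
Qed.

Lemma gauss_lobatto_weight_gt0 (R : realType) k (X w : nat -> R) l :
  gauss_lobatto k X w -> (l < k.+2)%N -> 0 < w l.
Proof.
move=> gl hl; have [X0 X1 _ _] := gl.
pose q := \prod_(m < k.+2 | (m : nat) != l) node_factor k X m.
have sq : (size q <= (2 * k).+2)%N.
  have node_nz m : node_factor k X m != 0.
    by rewrite -size_poly_gt0 size_node_factor; case: ifP.
  (* The product over all nodes has degree 2k+2: one from each end point and two from each of the k
     interior nodes. Dropping one factor leaves degree at most 2k+1. *)
  have sfull : size (\prod_(m < k.+2) node_factor k X m) = (2 * k).+3%N.
    rewrite size_prod; last by move=> m _; apply: node_nz.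
    rewrite big_ord_recl big_ord_recr /= !size_node_factor /= eqxx.
    rewrite (eq_bigr (fun=> 3%N)); last first.
      by move=> i _; rewrite size_node_factor /bump leq0n add1n eqSS (ltn_eqF (ltn_ord i)).
    rewrite sum_nat_const !card_ord.
    by apply/eqP; rewrite -(eqn_add2r k.+2) subnK; lia.
  have := sfull; rewrite (bigD1 (Ordinal hl)) //= -/q size_mul ?node_nz //; last first.
    by apply/prodf_neq0 => m _; apply: node_nz.
  rewrite size_node_factor.
  by move: (size q) => n; case: ifP => _; lia.
have q_gt0 (x : R) : -1 <= x <= 1 -> (forall m, (m < k.+2)%N -> m != l -> x != X m) -> 0 < q.[x].
  by move=> hx nx; rewrite horner_prod prodr_gt0 // => m ml; rewrite (node_factor_gt0 gl) ?nx.
have X01 : -1 < X 1%N by rewrite -X0 (gauss_lobatto_lt gl).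
have X11 : X 1%N <= 1.
  (* For k = 0 the node [X 1] is itself the right end point. *)
  rewrite -X1; case: (k) gl => [|n] gl //.
  by rewrite ltW // (gauss_lobatto_lt gl).
have bnd m : (m < k.+2)%N -> -1 <= X m <= 1.
  move=> hm; apply/andP; split.
    case: m hm => [_|m hm]; first by rewrite X0.
    by rewrite -X0 ltW // (gauss_lobatto_lt gl).
  have [->|mk] := eqVneq m k.+1; first by rewrite X1.
  by rewrite -X1 ltW // (gauss_lobatto_lt gl) // ltn_neqAle mk.
have q_ge0 (x : R) : -1 <= x <= 1 -> 0 <= q.[x].
  move=> hx; have [/existsP[m /andP[ml /eqP ->]]|/existsPn nx] :=
    boolP [exists m : 'I_k.+2, ((m : nat) != l) && (x == X m)].
    by rewrite horner_prod (bigD1 m) //= node_factor_root mul0r.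
  apply/ltW/q_gt0 => // m hm ml; apply/negP => xm.
  by have := nx (Ordinal hm); rewrite /= ml xm.
have [P P' sP] := exists_antideriv q.
(* The integral of q is strictly positive: q > 0 strictly between the first two nodes makes P
   increase there, and q >= 0 keeps P nondecreasing up to 1. *)
have P_lt : P.[-1] < P.[1].
  apply: (lt_le_trans (y := P.[X 1%N])).
    apply: (@derpr _ _ (-1) (X 1%N)); last by rewrite in_itv /= X01 lexx.
    move=> x; rewrite in_itv /= P' => /andP[x0 x1].
    apply: q_gt0 => [|m hm ml]; first by rewrite !ltW // (lt_le_trans x1).
    case: m hm ml => [_ _|[_ _|m hm _]]; first by rewrite X0 gt_eqF.
      by rewrite lt_eqF.
    by rewrite lt_eqF // (lt_trans x1) // (gauss_lobatto_lt gl).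
  apply: (@ler_hornerW _ (-1) 1) => //; rewrite ?in_itv /= ?lexx ?X11 ?(ltW X01) //.
    by move=> x; rewrite in_itv /= P' => /andP[x0 x1]; rewrite q_ge0 // !ltW.
  by rewrite andbT -subr_ge0 opprK; apply: ltW.
have sP' : (size P <= (2 * k).+3)%N by rewrite (leq_trans sP).
have := gauss_lobatto_deriv gl sP'.
rewrite P' (bigD1 (Ordinal hl)) //= big1 ?addr0; last first.
  move=> m; rewrite -val_eqE /= => ml.
  by rewrite /q horner_prod (bigD1 m) //= node_factor_root mul0r mulr0.
have ql : 0 < q.[X l].
  apply: q_gt0 => [|m hm ml]; first exact: bnd.
  by rewrite (gauss_lobatto_inj gl) // eq_sym.
move=> E; have : 0 < w l * q.[X l] by rewrite E subr_gt0.
by rewrite pmulr_lgt0.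
Qed.

(** * State vectors and their dot product *)

Lemma sum8E (R : realType) (f : 'I_8 -> R) :
  \sum_(c < 8) f c = f (@Ordinal 8 0 erefl) + f (@Ordinal 8 1 erefl) +
    f (@Ordinal 8 2 erefl) + f (@Ordinal 8 3 erefl) + f (@Ordinal 8 4 erefl) +
    f (@Ordinal 8 5 erefl) + f (@Ordinal 8 6 erefl) + f (@Ordinal 8 7 erefl).
Proof.
rewrite !big_ord_recr big_ord0 /= add0r.
by congr (_ + _ + _ + _ + _ + _ + _ + _); congr f; apply: val_inj.
Qed.

Lemma dot_compE (R : realType) (a b : state R) :
  dot a b = Defs.comp 0 a * Defs.comp 0 b + Defs.comp 1 a * Defs.comp 1 b +
    Defs.comp 2 a * Defs.comp 2 b + Defs.comp 3 a * Defs.comp 3 b +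
    Defs.comp 4 a * Defs.comp 4 b + Defs.comp 5 a * Defs.comp 5 b +
    Defs.comp 6 a * Defs.comp 6 b + Defs.comp 7 a * Defs.comp 7 b.
Proof. exact: sum8E. Qed.

Lemma dot_VentE (R : realType) (gamma : R) (U f : state R) :
  dot (Vent gamma U) f =
    ((gamma - sent gamma U) / (gamma - 1) - beta gamma U * usq U) * Defs.comp 0 f +
    2 * beta gamma U * ux U * Defs.comp 1 f + 2 * beta gamma U * uy U * Defs.comp 2 f +
    2 * beta gamma U * uz U * Defs.comp 3 f + - 2 * beta gamma U * Defs.comp 4 f +
    2 * beta gamma U * Bx U * Defs.comp 5 f + 2 * beta gamma U * By U * Defs.comp 6 f +
    2 * beta gamma U * Bz U * Defs.comp 7 f.
Proof. exact: dot_compE. Qed.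

Lemma eq_state (R : realType) (U V : state R) :
  (forall n, (n < 8)%N -> Defs.comp n U = Defs.comp n V) -> U = V.
Proof.
move=> UV; apply/funext => -[i hi]; have := UV i hi.
(* [comp] builds its ordinals with [erefl], so the two proofs of the bound must be identified. *)
by do 8 (case: i hi => [|i] hi; first by rewrite /= (bool_irrelevance hi erefl)).
Qed.

Lemma dotBl (R : realType) (a b f : 'I_8 -> R) :
  \sum_(c < 8) (a c - b c) * f c = dot a f - dot b f.
Proof. by rewrite /dot -sumrB; apply: eq_bigr => c _; rewrite mulrBl. Qed.

Lemma eq_dotr (R : realType) (a f g : 'I_8 -> R) : f =1 g -> dot a f = dot a g.
Proof. by move=> fg; apply: eq_bigr => c _; rewrite fg. Qed.

Lemma dotDr (R : realType) (a f g : 'I_8 -> R) :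
  dot a (fun c => f c + g c) = dot a f + dot a g.
Proof. by rewrite /dot -big_split; apply: eq_bigr => c _; rewrite mulrDr. Qed.

Lemma dotNr (R : realType) (a f : 'I_8 -> R) : dot a (fun c => - f c) = - dot a f.
Proof. by rewrite /dot -sumrN; apply: eq_bigr => c _; rewrite mulrN. Qed.

Lemma dotZr (R : realType) (a f : 'I_8 -> R) x : dot a (fun c => x * f c) = x * dot a f.
Proof. by rewrite /dot mulr_sumr; apply: eq_bigr => c _; rewrite mulrCA. Qed.

Lemma dot_sumr (R : realType) n (a : 'I_8 -> R) (x : 'I_n -> R) (f : 'I_n -> 'I_8 -> R) :
  dot a (fun c => \sum_(l < n) x l * f l c) = \sum_(l < n) x l * dot a (f l).
Proof.
rewrite /dot; under eq_bigr => c _ do rewrite mulr_sumr.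
rewrite exchange_big; apply: eq_bigr => l _; rewrite mulr_sumr.
by apply: eq_bigr => c _; rewrite mulrCA.
Qed.

(** * Time derivatives and the chain rule for the entropy *)

Section DerivativeRules.
Context {R : realType}.
Implicit Types (f g : R -> R) (t a b : R).

Lemma is_derive1D f g t a b : is_derive t 1 f a -> is_derive t 1 g b ->
  is_derive t 1 (fun s => f s + g s) (a + b).
Proof. by move=> df dg; apply: is_deriveD. Qed.

Lemma is_derive1B f g t a b : is_derive t 1 f a -> is_derive t 1 g b ->
  is_derive t 1 (fun s => f s - g s) (a - b).
Proof. by move=> df dg; apply: is_deriveB. Qed.

Lemma is_derive1M f g t a b : is_derive t 1 f a -> is_derive t 1 g b ->
  is_derive t 1 (fun s => f s * g s) (a * g t + f t * b).
Proof.
move=> df dg; apply: (is_derive_eq (is_deriveM df dg)).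
by rewrite /GRing.scale /= addrC [g t * a]mulrC.
Qed.

Lemma is_derive1Z f t a x : is_derive t 1 f a ->
  is_derive t 1 (fun s => x * f s) (x * a).
Proof. by move=> df; apply: is_deriveZ. Qed.

Lemma is_derive1X2 f t a : is_derive t 1 f a ->
  is_derive t 1 (fun s => f s ^+ 2) (2 * f t * a).
Proof.
move=> df; have := is_derive1M df df.
by under eq_fun => s do rewrite -expr2; move/is_derive_eq; apply; ring.
Qed.

Lemma is_derive1_div f g t a b : g t != 0 ->
  is_derive t 1 f a -> is_derive t 1 g b ->
  is_derive t 1 (fun s => f s / g s) ((a - f t / g t * b) / g t).
Proof.
move=> gt0 df dg; have := is_derive1M df (is_deriveV gt0 dg).
by move/is_derive_eq; apply; rewrite /GRing.scale /=; field.
Qed.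

Lemma is_derive1_bigsum n (f : 'I_n -> R -> R) t (a : 'I_n -> R) :
  (forall i, is_derive t 1 (f i) (a i)) ->
  is_derive t 1 (fun s => \sum_(i < n) f i s) (\sum_(i < n) a i).
Proof.
move=> df; have := is_derive_sum df; congr (is_derive _ _ _ _).
by apply/funext => s; rewrite fct_sumE.
Qed.

End DerivativeRules.

(** The entropy variables are the gradient of the entropy with respect to the conserved variables;
    admissibility keeps the quotients and the logarithm differentiable. *)
Lemma is_derive_Uent (R : realType) (gamma : R) (W : R -> state R) (dW : state R) t :
  1 < gamma -> admissible gamma (W t) ->
  (forall c, is_derive t 1 (fun s => W s c) (dW c)) ->
  is_derive t 1 (fun s => Uent gamma (W s)) (dot (Vent gamma (W t)) dW).
Proof.
move=> gt1 [r_gt0 p_gt0] D.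
have Dc n : is_derive t 1 (fun s => Defs.comp n (W s)) (Defs.comp n dW).
  by rewrite /Defs.comp; do 7 (case: n => [|n]; first exact: D); apply: D.
have r_n0 : rho (W t) != 0 by rewrite gt_eqF.
have Dr : is_derive t 1 (fun s => rho (W s)) (Defs.comp 0 dW) := Dc 0%N.
have Du : is_derive t 1 (fun s => usq (W s)) _ :=
  is_derive1D (is_derive1D (is_derive1X2 (is_derive1_div r_n0 (Dc 1%N) Dr))
    (is_derive1X2 (is_derive1_div r_n0 (Dc 2%N) Dr)))
    (is_derive1X2 (is_derive1_div r_n0 (Dc 3%N) Dr)).
have DB : is_derive t 1 (fun s => Bsq (W s)) _ :=
  is_derive1D (is_derive1D (is_derive1X2 (Dc 5%N)) (is_derive1X2 (Dc 6%N)))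
    (is_derive1X2 (Dc 7%N)).
have half_n0 : (2 : R) != 0 by rewrite pnatr_eq0.
have D2 := is_derive_cst (2 : R) t (1 : R).
have Dp : is_derive t 1 (fun s => pres gamma (W s)) _ :=
  is_derive1Z (gamma - 1) (is_derive1B (is_derive1B (Dc 4%N)
    (is_derive1_div (g := fun=> 2) half_n0 (is_derive1M Dr Du) D2))
    (is_derive1_div (g := fun=> 2) half_n0 DB D2)).
set dp := (X in is_derive _ _ (fun s => pres gamma (W s)) X) in Dp.
have q_gt0 : 0 < rho (W t) `^ (- gamma) by apply: powR_gt0.
(* The power [- gamma - 1] is written as a quotient by rho, so that the factor rho^(-gamma) cancels
   in the derivative of the logarithm. *)
have Dq : is_derive t 1 (fun s => rho (W s) `^ (- gamma))
    (- gamma * (rho (W t) `^ (- gamma) / rho (W t)) * Defs.comp 0 dW).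
  apply: is_derive_eq.
    exact: (is_derive1_comp (f := fun x => x `^ (- gamma)) (is_derive1_powR _ r_gt0) Dr).
  by rewrite powRD ?powR_inv1 ?ltW // r_n0 implybT.
have Ds : is_derive t 1 (fun s => sent gamma (W s))
    (dp / pres gamma (W t) - gamma * Defs.comp 0 dW / rho (W t)).
  have Dln := is_derive1_ln (mulr_gt0 p_gt0 q_gt0).
  apply: (is_derive_eq (is_derive1_comp (f := @ln R)
    (g := fun s => pres gamma (W s) * rho (W s) `^ (- gamma)) Dln (is_derive1M Dp Dq))).
  by field; rewrite r_n0 !gt_eqF.
have g_n0 : gamma - 1 != 0 by rewrite gt_eqF // subr_gt0.
have := is_derive1_div (g := fun=> gamma - 1) g_n0 (is_derive1M (is_derive1Z (-1) Dr) Ds)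
  (is_derive_cst (gamma - 1) t (1 : R)).
under eq_fun => s do rewrite mulN1r -/(Uent gamma (W s)).
move/is_derive_eq; apply; rewrite dot_VentE /dp.
rewrite /beta /usq /ux /uy /uz /Bx /By /Bz.
(* The remaining identity holds for any nonzero p and any s: only the differential [dp] has to be
   explicit, so the values become free variables. *)
move: r_n0 p_gt0 => r_n0 /lt0r_neq0; move: (pres _ _) (sent _ _) => p s p_n0.
by field; rewrite r_n0 p_n0 g_n0.
Qed.

(** * Entropy balance along a line of nodes *)

(* Symmetry of the flux lets S be replaced by its antisymmetric part, after which the
   entropy-conservation relation makes the double sum telescope. *)
Lemma sbp_entropy (R : realFieldType) n (S : 'I_n -> 'I_n -> R) (t psi phi B : 'I_n -> R)
    (vf : 'I_n -> 'I_n -> R) :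
  (forall i l, S i l + S l i = t i *+ (i == l)) ->
  (forall i, \sum_(l < n) S i l = 0) ->
  (forall i l, vf l i - vf i l = psi l - psi i - (phi l - phi i) * ((B l + B i) / 2)) ->
  \sum_(i < n) \sum_(l < n) 2 * S i l * vf i l =
  \sum_(i < n) t i * (vf i i - psi i + phi i * B i)
  - \sum_(i < n) phi i * \sum_(l < n) S i l * B l.
Proof.
move=> sbp row ec.
pose DS (f : 'I_n -> 'I_n -> R) := \sum_(i < n) \sum_(l < n) S i l * f i l.
have DSD f g : DS (fun i l => f i l + g i l) = DS f + DS g.
  rewrite /DS -big_split; apply: eq_bigr => i _ /=; rewrite -big_split.
  by apply: eq_bigr => l _; rewrite mulrDr.
have DSZ x f : DS (fun i l => x * f i l) = x * DS f.
  rewrite /DS mulr_sumr; apply: eq_bigr => i _; rewrite mulr_sumr.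
  by apply: eq_bigr => l _; rewrite mulrCA.
(* Three rules evaluate every sum below: functions of the row index give 0, symmetrized ones reduce
   to the diagonal, and functions of the column index therefore do too. *)
have DSrow f : DS (fun i _ => f i) = 0.
  by rewrite /DS big1 // => i _; rewrite -mulr_suml row mul0r.
have DSsym f : DS (fun i l => f i l + f l i) = \sum_(i < n) t i * f i i.
  rewrite DSD [DS (fun i l => f l i)]/DS exchange_big -big_split; apply: eq_bigr => i _ /=.
  rewrite -big_split /= (bigD1 i) //= -mulrDl sbp eqxx big1 ?addr0 // => l li.
  by rewrite -mulrDl sbp eq_sym (negPf li) mul0r.
have DScol f : DS (fun _ l => f l) = \sum_(i < n) t i * f i.
  have := DSsym (fun i _ => f i); rewrite (DSD (fun i _ => f i) (fun _ l => f l)).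
  by rewrite DSrow add0r.
(* Here 2 [vf i l] is the symmetric sum minus the jump [vf l i - vf i l]. The mixed products of the
   jump are split into a symmetric part, which goes to the diagonal, and [phi i * B l], which
   survives as the nonconservative term. *)
transitivity (DS (fun i l => (vf i l + vf l i) + (-1 * psi l + (psi i +
    (2^-1 * (phi l * B l) + (2^-1 * (phi i * B l + phi l * B i)
    + (-1 * (phi i * B l) + - 2^-1 * (phi i * B i)))))))).
  apply: eq_bigr => i _; apply: eq_bigr => l _.
  rewrite -mulrA mulrCA; congr (_ * _).
  by have := ec i l; lra.
rewrite (DSD (fun i l => vf i l + vf l i)) DSsym.
rewrite (DSD (fun _ l => -1 * psi l)) (DScol (fun l => -1 * psi l)).
rewrite (DSD (fun i _ => psi i)) DSrow add0r.
rewrite (DSD (fun _ l => 2^-1 * (phi l * B l))) (DScol (fun l => 2^-1 * (phi l * B l))).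
rewrite (DSD (fun i l => 2^-1 * (phi i * B l + phi l * B i))).
rewrite (DSZ _ (fun i l => phi i * B l + phi l * B i)) (DSsym (fun i l => phi i * B l)).
rewrite (DSD (fun i l => -1 * (phi i * B l))) (DSrow (fun i => - 2^-1 * (phi i * B i))).
rewrite (DSZ _ (fun i l => phi i * B l)) addr0 mulN1r !addrA.
congr (_ - _); last first.
  by apply: eq_bigr => i _; rewrite mulr_sumr; apply: eq_bigr => l _; rewrite mulrCA.
rewrite mulr_sumr -!big_split; apply: eq_bigr => i _ /=; by field.
Qed.

Lemma sum_tau (R : realType) k (g : nat -> R) :
  \sum_(i < k.+2) tau R k i * g i = g k.+1 - g 0%N.
Proof.
rewrite big_ord_recl big_ord_recr /= big1 ?add0r; last first.
  by move=> i _; rewrite /tau /bump leq0n add1n eqSS (ltn_eqF (ltn_ord i)) mul0r.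
by rewrite /tau /= eqxx mulN1r mul1r addrC.
Qed.

(* One coordinate direction of the scheme along a line of nodes u 0 ... u (k+1): V, psi, phi, B, F
   stand for the entropy variables, (psi_F, phi, B_x, F) or (psi_G, phi, B_y, G). *)
Lemma line_entropy (R : realType) k (X w : nat -> R) (adm : state R -> Prop)
    (V F : state R -> state R) (psi phi B : state R -> R)
    (FS : state R -> state R -> state R) (u Fstar : nat -> state R) (h : R) :
  gauss_lobatto k X w ->
  (forall U, adm U -> FS U U = F U) ->
  (forall UL UR, adm UL -> adm UR -> FS UL UR = FS UR UL) ->
  (forall UL UR, adm UL -> adm UR ->
     \sum_(c < 8) (V UR c - V UL c) * FS UL UR c
     = psi UR - psi UL - (phi UR - phi UL) * ((B UR + B UL) / 2)) ->
  (forall i, (i < k.+2)%N -> adm (u i)) ->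
  \sum_(i < k.+2) w i * dot (V (u i)) (fun c =>
      - h * (\sum_(l < k.+2) 2 * Dmat k X i l * FS (u i) (u l) c)
      + h * (tau R k i / w i) * (F (u i) c - Fstar i c)) =
  h * (\sum_(i < k.+2) w i * phi (u i) * (\sum_(l < k.+2) Dmat k X i l * B (u l))
       - ((dot (V (u k.+1)) (Fstar k.+1) - psi (u k.+1) + phi (u k.+1) * B (u k.+1))
          - (dot (V (u 0%N)) (Fstar 0%N) - psi (u 0%N) + phi (u 0%N) * B (u 0%N)))).
Proof.
move=> gl cons sym ec adm_u'.
have adm_u (i : 'I_k.+2) : adm (u i) by apply: adm_u'.
have w_n0 (i : 'I_k.+2) : w i != 0 by rewrite gt_eqF // (gauss_lobatto_weight_gt0 gl).
rewrite -(sum_tau k (fun i => dot (V (u i)) (Fstar i) - psi (u i) + phi (u i) * B (u i))).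
pose S (i l : 'I_k.+2) := w i * Dmat k X i l.
pose vf (i l : 'I_k.+2) := dot (V (u i)) (FS (u i) (u l)).
have S_sbp i l : S i l + S l i = tau R k i *+ (i == l) by rewrite /S (Dmat_sbp gl).
have S_row i : \sum_(l < k.+2) S i l = 0 by rewrite -mulr_sumr (Dmat_row_sum _ gl) mulr0.
have vf_ec (i l : 'I_k.+2) : vf l i - vf i l = psi (u l) - psi (u i)
    - (phi (u l) - phi (u i)) * ((B (u l) + B (u i)) / 2).
  by rewrite -ec // dotBl /vf [FS (u l) _]sym.
have sbp := sbp_entropy S_sbp S_row vf_ec.
(* The quadrature weight cancels the [1 / w i] of the boundary correction, and consistency turns
   [F (u i)] into the diagonal value [vf i i]. *)
transitivity (- h * (\sum_(i < k.+2) \sum_(l < k.+2) 2 * S i l * vf i l)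
   + h * \sum_(i < k.+2) tau R k i * (vf i i - dot (V (u i)) (Fstar i))).
  rewrite (mulr_sumr _ _ _ (- h)) (mulr_sumr _ _ _ h) -big_split.
  apply: eq_bigr => i _ /=.
  rewrite dotDr !dotZr dot_sumr dotDr dotNr /vf cons // mulrDr.
  congr (_ + _); last by field; rewrite w_n0.
  rewrite mulrCA; congr (_ * _); rewrite mulr_sumr; apply: eq_bigr => l _.
  by rewrite /S; ring.
(* The values [vf i i] cancel between the volume sum and the boundary correction, leaving the
   numerical entropy fluxes of the end points. *)
rewrite sbp mulNr -mulrN -mulrDr; congr (_ * _).
rewrite opprB -addrA; congr (_ + _).
  apply: eq_bigr => i _; rewrite [w i * _]mulrC -mulrA; congr (_ * _).
  by rewrite mulr_sumr; apply: eq_bigr => l _; rewrite /S mulrA.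
by rewrite addrC -sumrB -sumrN; apply: eq_bigr => i _; ring.
Qed.

(** * Dissipation at interfaces and boundaries *)

(** Continuity of the normal field makes the average of B equal to the face value, so the entropy
    stability inequality rearranges into a comparison of the entropy fluxes seen from both sides. *)
Lemma interface_dissipation (R : realType) (adm : state R -> Prop)
    (V : state R -> state R) (psi phi B : state R -> R)
    (H : state R -> state R -> state R) UL UR :
  (forall UL UR, adm UL -> adm UR ->
     \sum_(c < 8) (V UR c - V UL c) * H UL UR c
     <= psi UR - psi UL - (phi UR - phi UL) * ((B UR + B UL) / 2)) ->
  adm UL -> adm UR -> B UL = B UR ->
  dot (V UR) (H UL UR) - psi UR + phi UR * B UL
  <= dot (V UL) (H UL UR) - psi UL + phi UL * B UL.
Proof.
move=> es aL aR BLR; have := es _ _ aL aR; rewrite dotBl -BLR.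
have -> : (B UL + B UL) / 2 = B UL by field.
rewrite mulrBl; lra.
Qed.

(* In a wall flux H(MU,U) mirror invariance gives M f = -f; as V commutes with the self-adjoint M,
   the entropy jump is twice V(U) . f, and B(MU) + B(U) = 0 removes the phi term. *)
Lemma wall_dissipation (R : realType) (adm : state R -> Prop)
    (V M : state R -> state R) (psi phi B : state R -> R)
    (H : state R -> state R -> state R) U :
  (forall UL UR, adm UL -> adm UR ->
     \sum_(c < 8) (V UR c - V UL c) * H UL UR c
     <= psi UR - psi UL - (phi UR - phi UL) * ((B UR + B UL) / 2)) ->
  (forall UL UR, adm UL -> adm UR -> forall c, H (M UR) (M UL) c = - M (H UL UR) c) ->
  (forall U, M (M U) = U) -> (forall a b, dot (M a) b = dot a (M b)) ->
  (forall U, V (M U) = M (V U)) -> (forall U, psi (M U) = - psi U) ->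
  (forall U, B (M U) = - B U) ->
  adm U -> adm (M U) ->
  dot (V U) (H (M U) U) - psi U <= 0 <= dot (V U) (H U (M U)) - psi U.
Proof.
move=> es mir MK Madj VM psiM BM aU aMU.
have wall U1 : adm U1 -> adm (M U1) ->
    dot (V (M U1)) (H (M U1) U1) = - dot (V U1) (H (M U1) U1).
  move=> a1 a2; rewrite VM Madj -dotNr; apply: eq_dotr => c.
  by have := mir _ _ a2 a1 c; rewrite MK => ->; rewrite opprK.
have := es _ _ aMU aU; have := es _ _ aU aMU.
rewrite !dotBl psiM BM subrr addNr !mul0r !mulr0 !subr0 wall //.
have := wall (M U); rewrite MK => /(_ aMU aU) ->.
by move=> h1 h2; apply/andP; split; lra.
Qed.

(** Serves both directions: [a i] and [b i] are the traces of cell i at its two ends along a row of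
    cells, [nl i] and [nr i] the states beyond them. The sum is regrouped by interfaces instead of
    cells. *)
Lemma line_sum_ge0 (R : realType) N (bx : bc R) (adm : state R -> Prop)
    (V M : state R -> state R) (psi phi B : state R -> R)
    (H : state R -> state R -> state R) (a b nl nr : nat -> state R) :
  (0 < N)%N ->
  nl = (fun i => if i == 0%N then
          match bx with Periodic => b N.-1 | Reflective => M (a 0%N) | Compact Ub => Ub end
        else b i.-1) ->
  nr = (fun i => if i == N.-1 then
          match bx with Periodic => a 0%N | Reflective => M (b i) | Compact Ub => Ub end
        else a i.+1) ->
  (forall UL UR, adm UL -> adm UR ->
     \sum_(c < 8) (V UR c - V UL c) * H UL UR c
     <= psi UR - psi UL - (phi UR - phi UL) * ((B UR + B UL) / 2)) ->
  (bx = Reflective R ->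
     forall UL UR, adm UL -> adm UR -> forall c, H (M UR) (M UL) c = - M (H UL UR) c) ->
  (forall U, M (M U) = U) -> (forall a b, dot (M a) b = dot a (M b)) ->
  (forall U, V (M U) = M (V U)) -> (forall U, psi (M U) = - psi U) ->
  (forall U, B (M U) = - B U) -> (forall U, adm U -> adm (M U)) ->
  (forall i, (i < N)%N -> adm (a i)) -> (forall i, (i < N)%N -> adm (b i)) ->
  (forall Ub, bx = Compact Ub -> a 0%N = Ub /\ b N.-1 = Ub) ->
  (forall i, (i < N)%N -> B (b i) = B (nr i) /\ B (a i) = B (nl i)) ->
  0 <= \sum_(i < N)
    ((dot (V (b i)) (H (b i) (nr i)) - psi (b i) + phi (b i) * B (b i))
     - (dot (V (a i)) (H (nl i) (a i)) - psi (a i) + phi (a i) * B (nl i))).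
Proof.
case: N => // n _ nlE nrE es mir MK Madj VM psiM BM admM adm_a adm_b cpt Bcont.
pose fR i := dot (V (b i)) (H (b i) (nr i)) - psi (b i) + phi (b i) * B (b i).
pose fL i := dot (V (a i)) (H (nl i) (a i)) - psi (a i) + phi (a i) * B (nl i).
rewrite sumrB (big_ord_recr _ fR) (big_ord_recl _ fL) /=.
(* The flux from the right end of cell i is paired with that from the left end of cell i+1; the two
   outermost fluxes are left for the boundary condition. *)
rewrite [fL 0%N + _]addrC opprD addrACA -sumrB; apply: addr_ge0.
  apply: sumr_ge0 => i _; rewrite subr_ge0 /fL /fR /bump leq0n add1n.
  have [hi hi'] : (i < n.+1)%N /\ (i.+1 < n.+1)%N by have := ltn_ord i; lia.
  have [Bb _] := Bcont _ hi.
  move: Bb; rewrite nlE nrE /= (ltn_eqF (ltn_ord i)) => Bb.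
  by apply: (interface_dissipation es); auto.
have [Bb _] := Bcont _ (ltnSn n); have [_ Ba] := Bcont _ (ltn0Sn n).
have Ea := adm_a _ (ltn0Sn n); have Eb := adm_b _ (ltnSn n).
move: Ba Bb; rewrite /fR /fL nlE nrE /= eqxx.
(* Periodicity makes the two ends one more interface, reflection gives two walls, and compact
   support gives equal fluxes at both ends. *)
case: bx mir cpt {nlE nrE} => [||Ub] mir cpt Ba Bb.
- by rewrite subr_ge0; apply: (interface_dissipation es); auto.
(* Continuity of B with its mirrored ghost value forces B = 0 at the wall. *)
- have zero x : x = - x -> x = 0 :> R by lra.
  rewrite !BM in Ba Bb *; rewrite -Ba (zero _ Ba) (zero _ Bb) !mulr0 !addr0.
  have := wall_dissipation (phi := phi) es (mir erefl) MK Madj VM psiM BM Ea (admM _ Ea).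
  have := wall_dissipation (phi := phi) es (mir erefl) MK Madj VM psiM BM Eb (admM _ Eb).
  by move=> /andP[_ h1] /andP[h2 _]; rewrite subr_ge0 (le_trans h2).
- by have [-> ->] := cpt _ erefl; rewrite subrr.
Qed.

(** * Mirror symmetry of the entropy variables and potentials *)

Lemma psiFE (R : realType) (gamma : R) (U : state R) :
  psiF gamma U =
    ((gamma - sent gamma U) / (gamma - 1) - beta gamma U * usq U) * (rho U * ux U) +
    2 * beta gamma U * ux U * (rho U * ux U ^+ 2 + pstar gamma U - Bx U ^+ 2) +
    2 * beta gamma U * uy U * (rho U * ux U * uy U - Bx U * By U) +
    2 * beta gamma U * uz U * (rho U * ux U * uz U - Bx U * Bz U) +
    - 2 * beta gamma U * (ux U * (Etot U + pstar gamma U) - Bx U * udotB U) +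
    2 * beta gamma U * Bx U * 0 + 2 * beta gamma U * By U * (ux U * By U - uy U * Bx U) +
    2 * beta gamma U * Bz U * (ux U * Bz U - uz U * Bx U) - Fent gamma U.
Proof. by rewrite /psiF dot_VentE. Qed.

Lemma psiGE (R : realType) (gamma : R) (U : state R) :
  psiG gamma U =
    ((gamma - sent gamma U) / (gamma - 1) - beta gamma U * usq U) * (rho U * uy U) +
    2 * beta gamma U * ux U * (rho U * ux U * uy U - Bx U * By U) +
    2 * beta gamma U * uy U * (rho U * uy U ^+ 2 + pstar gamma U - By U ^+ 2) +
    2 * beta gamma U * uz U * (rho U * uy U * uz U - By U * Bz U) +
    - 2 * beta gamma U * (uy U * (Etot U + pstar gamma U) - By U * udotB U) +
    2 * beta gamma U * Bx U * (uy U * Bx U - ux U * By U) + 2 * beta gamma U * By U * 0 +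
    2 * beta gamma U * Bz U * (uy U * Bz U - uz U * By U) - Gent gamma U.
Proof. by rewrite /psiG dot_VentE. Qed.

Lemma mirror_xK (R : realType) (U : state R) : mirror_x (mirror_x U) = U.
Proof.
by apply: eq_state => -[|[|[|[|[|[|[|[|n]]]]]]]] //= _; apply: opprK.
Qed.

Lemma mirror_yK (R : realType) (U : state R) : mirror_y (mirror_y U) = U.
Proof.
by apply: eq_state => -[|[|[|[|[|[|[|[|n]]]]]]]] //= _; apply: opprK.
Qed.

(** The mirror map is a diagonal matrix with entries 1 and -1, so both sides are the same signed
    sum. *)
Lemma dot_mirror_x (R : realType) (a b : state R) : dot (mirror_x a) b = dot a (mirror_x b).
Proof.
have dotM c d : dot (mirror_x c) d = Defs.comp 0 c * Defs.comp 0 d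
    - Defs.comp 1 c * Defs.comp 1 d + Defs.comp 2 c * Defs.comp 2 d
    + Defs.comp 3 c * Defs.comp 3 d + Defs.comp 4 c * Defs.comp 4 d
    - Defs.comp 5 c * Defs.comp 5 d + Defs.comp 6 c * Defs.comp 6 d
    + Defs.comp 7 c * Defs.comp 7 d by rewrite dot_compE -!mulNr.
have -> : dot a (mirror_x b) = dot (mirror_x b) a by apply: eq_bigr => c _; rewrite mulrC.
by rewrite !dotM; ring.
Qed.

Lemma dot_mirror_y (R : realType) (a b : state R) : dot (mirror_y a) b = dot a (mirror_y b).
Proof.
have dotM c d : dot (mirror_y c) d = Defs.comp 0 c * Defs.comp 0 d
    + Defs.comp 1 c * Defs.comp 1 d - Defs.comp 2 c * Defs.comp 2 d
    + Defs.comp 3 c * Defs.comp 3 d + Defs.comp 4 c * Defs.comp 4 d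
    + Defs.comp 5 c * Defs.comp 5 d - Defs.comp 6 c * Defs.comp 6 d
    + Defs.comp 7 c * Defs.comp 7 d by rewrite dot_compE -!mulNr.
have -> : dot a (mirror_y b) = dot (mirror_y b) a by apply: eq_bigr => c _; rewrite mulrC.
by rewrite !dotM; ring.
Qed.

Section Mirror.
Context {R : realType}.
Variables (gamma : R) (U : state R).

Lemma ux_mirror_x : ux (mirror_x U) = - ux U. Proof. exact: mulNr. Qed.
Lemma uy_mirror_y : uy (mirror_y U) = - uy U. Proof. exact: mulNr. Qed.
Lemma Bx_mirror_x : Bx (mirror_x U) = - Bx U. Proof. by []. Qed.
Lemma By_mirror_y : By (mirror_y U) = - By U. Proof. by []. Qed.

Lemma usq_mirror_x : usq (mirror_x U) = usq U.
Proof. by rewrite /usq ux_mirror_x sqrrN. Qed.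
Lemma usq_mirror_y : usq (mirror_y U) = usq U.
Proof. by rewrite /usq uy_mirror_y sqrrN. Qed.
Lemma Bsq_mirror_x : Bsq (mirror_x U) = Bsq U.
Proof. by rewrite /Bsq Bx_mirror_x sqrrN. Qed.
Lemma Bsq_mirror_y : Bsq (mirror_y U) = Bsq U.
Proof. by rewrite /Bsq By_mirror_y sqrrN. Qed.
Lemma udotB_mirror_x : udotB (mirror_x U) = udotB U.
Proof. by rewrite /udotB ux_mirror_x Bx_mirror_x mulrNN. Qed.
Lemma udotB_mirror_y : udotB (mirror_y U) = udotB U.
Proof. by rewrite /udotB uy_mirror_y By_mirror_y mulrNN. Qed.

Lemma pres_mirror_x : pres gamma (mirror_x U) = pres gamma U.
Proof. by rewrite /pres usq_mirror_x Bsq_mirror_x. Qed.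
Lemma pres_mirror_y : pres gamma (mirror_y U) = pres gamma U.
Proof. by rewrite /pres usq_mirror_y Bsq_mirror_y. Qed.
Lemma pstar_mirror_x : pstar gamma (mirror_x U) = pstar gamma U.
Proof. by rewrite /pstar pres_mirror_x Bsq_mirror_x. Qed.
Lemma pstar_mirror_y : pstar gamma (mirror_y U) = pstar gamma U.
Proof. by rewrite /pstar pres_mirror_y Bsq_mirror_y. Qed.
Lemma sent_mirror_x : sent gamma (mirror_x U) = sent gamma U.
Proof. by rewrite /sent pres_mirror_x. Qed.
Lemma sent_mirror_y : sent gamma (mirror_y U) = sent gamma U.
Proof. by rewrite /sent pres_mirror_y. Qed.
Lemma beta_mirror_x : beta gamma (mirror_x U) = beta gamma U.
Proof. by rewrite /beta pres_mirror_x. Qed.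
Lemma beta_mirror_y : beta gamma (mirror_y U) = beta gamma U.
Proof. by rewrite /beta pres_mirror_y. Qed.

Lemma admissible_mirror_x : admissible gamma U -> admissible gamma (mirror_x U).
Proof. by rewrite /admissible pres_mirror_x. Qed.
Lemma admissible_mirror_y : admissible gamma U -> admissible gamma (mirror_y U).
Proof. by rewrite /admissible pres_mirror_y. Qed.

Lemma Vent_mirror_x : Vent gamma (mirror_x U) = mirror_x (Vent gamma U).
Proof.
rewrite /Vent beta_mirror_x sent_mirror_x usq_mirror_x ux_mirror_x Bx_mirror_x.
by apply: eq_state => -[|[|[|[|[|[|[|[|n]]]]]]]] //= _; apply: mulrN.
Qed.
Lemma Vent_mirror_y : Vent gamma (mirror_y U) = mirror_y (Vent gamma U).
Proof.
rewrite /Vent beta_mirror_y sent_mirror_y usq_mirror_y uy_mirror_y By_mirror_y.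
by apply: eq_state => -[|[|[|[|[|[|[|[|n]]]]]]]] //= _; apply: mulrN.
Qed.

(** Each term of the expanded potential is odd under the joint sign change of u_x and B_x, since the
    pressure, [sent], [beta] and u . B are invariant. *)
Lemma psiF_mirror_x : psiF gamma (mirror_x U) = - psiF gamma U.
Proof.
rewrite !psiFE /Fent beta_mirror_x sent_mirror_x usq_mirror_x ux_mirror_x Bx_mirror_x.
rewrite pstar_mirror_x udotB_mirror_x.
rewrite -[rho _]/(rho U) -[uy (mirror_x U)]/(uy U) -[uz (mirror_x U)]/(uz U).
rewrite -[By (mirror_x U)]/(By U) -[Bz (mirror_x U)]/(Bz U) -[Etot (mirror_x U)]/(Etot U).
ring.
Qed.

Lemma psiG_mirror_y : psiG gamma (mirror_y U) = - psiG gamma U.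
Proof.
rewrite !psiGE /Gent beta_mirror_y sent_mirror_y usq_mirror_y uy_mirror_y By_mirror_y.
rewrite pstar_mirror_y udotB_mirror_y.
rewrite -[rho _]/(rho U) -[ux (mirror_y U)]/(ux U) -[uz (mirror_y U)]/(uz U).
rewrite -[Bx (mirror_y U)]/(Bx U) -[Bz (mirror_y U)]/(Bz U) -[Etot (mirror_y U)]/(Etot U).
ring.
Qed.

End Mirror.

(** * Entropy balance in one cell *)

(* The nonconservative terms phi * (D B) left over by the two directions add up to phi times the
   discrete divergence of B. *)
Lemma cell_entropy_balance (R : realType) (gamma : R) k Nx Ny (X w : nat -> R) (dx dy : R)
    (FS GS Fh Gh : state R -> state R -> state R) (bx by_ : bc R) (W : meshfun R) i j :
  dx != 0 -> dy != 0 -> gauss_lobatto k X w ->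
  ec_flux_x gamma FS -> ec_flux_y gamma GS ->
  (forall i1 j1, (i1 < k.+2)%N -> (j1 < k.+2)%N -> admissible gamma (W i j i1 j1)) ->
  divfree k Nx Ny bx by_ X dx dy W -> (i < Nx)%N -> (j < Ny)%N ->
  dx * dy / 4 * \sum_(i1 < k.+2) \sum_(j1 < k.+2) w i1 * w j1 *
    dot (Vent gamma (W i j i1 j1))
        (rhs gamma k Nx Ny bx by_ X w dx dy FS GS Fh Gh W i j i1 j1) =
  - (\sum_(j1 < k.+2) dy / 2 * w j1 *
       (FentR gamma k Nx bx Fh W i j j1 - FentL gamma k Nx bx Fh W i j j1))
  - (\sum_(i1 < k.+2) dx / 2 * w i1 *
       (GentT gamma k Ny by_ Gh W i j i1 - GentB gamma k Ny by_ Gh W i j i1)).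
Proof.
move=> dx0 dy0 gl [Fcons Fsym Fec] [Gcons Gsym Gec] adm [div0 Bxc Byc] hi hj.
pose Fst i1 j1 := Fstar k Nx bx Fh W i j i1 j1.
pose Gst i1 j1 := Gstar k Ny by_ Gh W i j i1 j1.
pose V i1 j1 := Vent gamma (W i j i1 j1).
pose xp i1 j1 := dot (V i1 j1) (fun c =>
  - (2 / dx) * (\sum_(l < k.+2) 2 * Dmat k X i1 l * FS (W i j i1 j1) (W i j l j1) c)
  + (2 / dx) * (tau R k i1 / w i1) * (Fx gamma (W i j i1 j1) c - Fst i1 j1 c)).
pose yp i1 j1 := dot (V i1 j1) (fun c =>
  - (2 / dy) * (\sum_(l < k.+2) 2 * Dmat k X j1 l * GS (W i j i1 j1) (W i j i1 l) c)
  + (2 / dy) * (tau R k j1 / w j1) * (Gy gamma (W i j i1 j1) c - Gst i1 j1 c)).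
have rhsE i1 j1 : dot (V i1 j1)
    (rhs gamma k Nx Ny bx by_ X w dx dy FS GS Fh Gh W i j i1 j1) = xp i1 j1 + yp i1 j1.
  rewrite -dotDr; apply: eq_dotr => c; rewrite /rhs -/(Fst i1 j1) -/(Gst i1 j1).
  by rewrite -!addrA !mulNr.
pose P i1 j1 := phi gamma (W i j i1 j1).
have xline (j1 : 'I_k.+2) : \sum_(i1 < k.+2) w i1 * xp i1 j1 =
    2 / dx * (\sum_(i1 < k.+2) w i1 * P i1 j1 *
                (\sum_(l < k.+2) Dmat k X i1 l * Bx (W i j l j1))
              - (FentR gamma k Nx bx Fh W i j j1 - FentL gamma k Nx bx Fh W i j j1)).
  (* [FentL] uses the neighbour's B_x; normal continuity replaces it by the cell's own trace, as
     [line_entropy] requires. *)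
  rewrite /FentL -(Bxc i j j1 hi hj (ltn_ord j1)).2.
  exact: (@line_entropy R k X w _ _ _ _ _ _ _ (fun i1 => W i j i1 j1)
    (fun i1 => Fst i1 j1) _ gl Fcons Fsym Fec (fun i1 h => adm i1 j1 h (ltn_ord j1))).
have yline (i1 : 'I_k.+2) : \sum_(j1 < k.+2) w j1 * yp i1 j1 =
    2 / dy * (\sum_(j1 < k.+2) w j1 * P i1 j1 *
                (\sum_(l < k.+2) Dmat k X j1 l * By (W i j i1 l))
              - (GentT gamma k Ny by_ Gh W i j i1 - GentB gamma k Ny by_ Gh W i j i1)).
  rewrite /GentB -(Byc i j i1 hi hj (ltn_ord i1)).2.
  exact: (@line_entropy R k X w _ _ _ _ _ _ _ (fun j1 => W i j i1 j1)
    (fun j1 => Gst i1 j1) _ gl Gcons Gsym Gec (fun j1 h => adm i1 j1 (ltn_ord i1) h)).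
(* The x part is regrouped along horizontal lines of nodes and the y part along vertical ones. *)
have -> : \sum_(i1 < k.+2) \sum_(j1 < k.+2) w i1 * w j1 *
      dot (Vent gamma (W i j i1 j1)) (rhs gamma k Nx Ny bx by_ X w dx dy FS GS Fh Gh W i j i1 j1)
    = \sum_(j1 < k.+2) w j1 * (\sum_(i1 < k.+2) w i1 * xp i1 j1)
    + \sum_(i1 < k.+2) w i1 * (\sum_(j1 < k.+2) w j1 * yp i1 j1).
  under [X in _ = X + _]eq_bigr => j1 _ do rewrite mulr_sumr.
  rewrite [X in _ = X + _]exchange_big -big_split; apply: eq_bigr => i1 _ /=.
  rewrite mulr_sumr -big_split; apply: eq_bigr => j1 _ /=.
  by rewrite rhsE; ring.
have div_terms :
    \sum_(j1 < k.+2) w j1 * (2 / dx * \sum_(i1 < k.+2) w i1 * P i1 j1 *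
                (\sum_(l < k.+2) Dmat k X i1 l * Bx (W i j l j1)))
    + \sum_(i1 < k.+2) w i1 * (2 / dy * \sum_(j1 < k.+2) w j1 * P i1 j1 *
                (\sum_(l < k.+2) Dmat k X j1 l * By (W i j i1 l))) = 0.
  under [X in X + _]eq_bigr => j1 _ do rewrite 2!mulr_sumr.
  rewrite [X in X + _]exchange_big -big_split big1 // => i1 _ /=.
  rewrite 2!mulr_sumr -big_split big1 // => j1 _ /=.
  have D0 : 2 / dx * (\sum_(l < k.+2) Dmat k X i1 l * Bx (W i j l j1))
      + 2 / dy * (\sum_(l < k.+2) Dmat k X j1 l * By (W i j i1 l)) = 0.
    rewrite -[RHS](div0 i j i1 j1 hi hj (ltn_ord i1) (ltn_ord j1)) !mulr_sumr -big_split.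
    by apply: eq_bigr => l _; rewrite /= !mulrA.
  transitivity (w i1 * w j1 * P i1 j1 * 0); last by rewrite mulr0.
  by rewrite -[in RHS]D0; ring.
under eq_bigr => j1 _ do rewrite xline mulrBr mulrBr.
under [X in _ + X]eq_bigr => i1 _ do rewrite yline mulrBr mulrBr.
rewrite !sumrB addrACA div_terms add0r -opprD mulrN -opprD; congr (- _).
(* The factor [dx * dy / 4] times [2 / dx] is [dy / 2], and likewise with the directions
   exchanged. *)
rewrite mulrDr !mulr_sumr; congr (_ + _); apply: eq_bigr => l _; field.
all: by rewrite ?dx0 ?dy0.
Qed.

(** * Time evolution of the entropy, per cell and on the whole domain *)

Unset Implicit Arguments.

Theorem theorem3p6 (R : realType) (gamma : R) (k Nx Ny : nat) (a b c d : R)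
  (X w : nat -> R)
  (FS GS Fh Gh : state R -> state R -> state R)
  (bx by_ : bc R) (Wt : R -> meshfun R) (t : R) :
  1 < gamma ->
  a < b -> c < d -> (0 < Nx)%N -> (0 < Ny)%N ->
  gauss_lobatto k X w ->
  ec_flux_x gamma FS -> ec_flux_y gamma GS ->
  es_flux_x gamma Fh -> es_flux_y gamma Gh ->
  (bx = Reflective R -> mirror_invariant_x gamma Fh) ->
  (by_ = Reflective R -> mirror_invariant_y gamma Gh) ->
  let dx := (b - a) / Nx%:R in
  let dy := (d - c) / Ny%:R in
  (* admissible nodal states at time t *)
  (forall i j i1 j1, (i < Nx)%N -> (j < Ny)%N -> (i1 < k.+2)%N -> (j1 < k.+2)%N ->
     admissible gamma (Wt t i j i1 j1)) ->
  (* boundary condition: periodic, reflective, or compactly supported *)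
  bc_compat k Nx Ny bx by_ (Wt t) ->
  (* the semi-discrete scheme holds at time t *)
  (forall i j i1 j1 (cc : 'I_8),
     (i < Nx)%N -> (j < Ny)%N -> (i1 < k.+2)%N -> (j1 < k.+2)%N ->
     is_derive t 1 (fun s => Wt s i j i1 j1 cc)
       (rhs gamma k Nx Ny bx by_ X w dx dy FS GS Fh Gh (Wt t) i j i1 j1 cc)) ->
  (* globally divergence-free nodal magnetic field at time t *)
  divfree k Nx Ny bx by_ X dx dy (Wt t) ->
  (forall i j, (i < Nx)%N -> (j < Ny)%N ->
     is_derive t 1 (fun s => cell_entropy gamma k w dx dy (Wt s) i j)
       (- (\sum_(j1 < k.+2) dy / 2 * w j1 *
             (FentR gamma k Nx bx Fh (Wt t) i j j1
              - FentL gamma k Nx bx Fh (Wt t) i j j1))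
        - (\sum_(i1 < k.+2) dx / 2 * w i1 *
             (GentT gamma k Ny by_ Gh (Wt t) i j i1
              - GentB gamma k Ny by_ Gh (Wt t) i j i1))))
  /\
  (derivable (fun s => total_entropy gamma k Nx Ny w dx dy (Wt s)) t 1 /\
   'D_1 (fun s => total_entropy gamma k Nx Ny w dx dy (Wt s)) t <= 0).
Proof.
move=> gt1 ab cd Nx0 Ny0 gl ecF ecG esF esG mirF mirG dx dy adm cpt scheme divf.
have dx_gt0 : 0 < dx by rewrite divr_gt0 ?subr_gt0 ?ltr0n.
have dy_gt0 : 0 < dy by rewrite divr_gt0 ?subr_gt0 ?ltr0n.
have w_gt0 (l : 'I_k.+2) : 0 < w l by apply: (gauss_lobatto_weight_gt0 gl).
have cell i j : (i < Nx)%N -> (j < Ny)%N ->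
    is_derive t 1 (fun s => cell_entropy gamma k w dx dy (Wt s) i j)
      (- (\sum_(j1 < k.+2) dy / 2 * w j1 *
            (FentR gamma k Nx bx Fh (Wt t) i j j1
             - FentL gamma k Nx bx Fh (Wt t) i j j1))
       - (\sum_(i1 < k.+2) dx / 2 * w i1 *
            (GentT gamma k Ny by_ Gh (Wt t) i j i1
             - GentB gamma k Ny by_ Gh (Wt t) i j i1))).
  move=> hi hj.
  have bal := @cell_entropy_balance R gamma k Nx Ny X w dx dy FS GS Fh Gh bx by_ (Wt t) i j
    (lt0r_neq0 dx_gt0) (lt0r_neq0 dy_gt0) gl ecF ecG
    (fun i1 j1 h1 h2 => adm i j i1 j1 hi hj h1 h2) divf hi hj.
  rewrite -bal.
  apply: is_derive1Z; apply: is_derive1_bigsum => i1; apply: is_derive1_bigsum => j1.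
  apply: is_derive1Z; apply: is_derive_Uent => // [|c0]; first exact: adm.
  exact: scheme.
split; first exact: cell.
have total : is_derive t 1 (fun s => total_entropy gamma k Nx Ny w dx dy (Wt s))
    (\sum_(i < Nx) \sum_(j < Ny)
      (- (\sum_(j1 < k.+2) dy / 2 * w j1 *
            (FentR gamma k Nx bx Fh (Wt t) i j j1
             - FentL gamma k Nx bx Fh (Wt t) i j j1))
       - (\sum_(i1 < k.+2) dx / 2 * w i1 *
            (GentT gamma k Ny by_ Gh (Wt t) i j i1
             - GentB gamma k Ny by_ Gh (Wt t) i j i1)))).
  rewrite (_ : (fun s => _) = fun s => \sum_(i < Nx) \sum_(j < Ny)
      cell_entropy gamma k w dx dy (Wt s) i j); last first.
    apply/funext => s; rewrite /total_entropy mulr_sumr; apply: eq_bigr => i _.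
    by rewrite mulr_sumr.
  by apply: is_derive1_bigsum => i; apply: is_derive1_bigsum => j; apply: cell.
split; first exact: ex_derive.
rewrite derive_val.
under eq_bigr => i _ do (under eq_bigr => j _ do rewrite -opprD; rewrite sumrN).
rewrite sumrN oppr_le0.
under eq_bigr => i _ do rewrite big_split /=.
rewrite big_split /= addr_ge0 //.
  (* With j and j1 fixed, the inner sum over i runs along one row of cells, which is the setting of
     [line_sum_ge0]. *)
  rewrite exchange_big /= sumr_ge0 // => j _; rewrite exchange_big /= sumr_ge0 // => j1 _.
  rewrite -mulr_sumr mulr_ge0 //.
    by apply/ltW/mulr_gt0 => //; rewrite divr_gt0 ?ltr0n.
  under eq_bigr => i _ do rewrite /FentR /FentL /Fstar /= eqxx.
  apply: (@line_sum_ge0 R Nx bx (admissible gamma) (Vent gamma) (@mirror_x R) (psiF gamma)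
    (phi gamma) (@Bx R) Fh (fun i => Wt t i j 0%N j1) (fun i => Wt t i j k.+1 j1)
    (fun i => nbL k Nx bx (Wt t) i j j1) (fun i => nbR k Nx bx (Wt t) i j j1)) => //.
  - exact: esF.2.
  - exact: mirror_xK.
  - exact: dot_mirror_x.
  - exact: Vent_mirror_x.
  - exact: psiF_mirror_x.
  - exact: admissible_mirror_x.
  - by move=> i hi; apply: adm.
  - by move=> i hi; apply: adm.
  - by move=> Ub bxE; apply: (cpt.1 Ub bxE).
  - by move=> i hi; have [_ + _] := divf; apply.
rewrite sumr_ge0 // => i _; rewrite exchange_big /= sumr_ge0 // => i1 _.
rewrite -mulr_sumr mulr_ge0 //.
  by apply/ltW/mulr_gt0 => //; rewrite divr_gt0 ?ltr0n.
under eq_bigr => j _ do rewrite /GentT /GentB /Gstar /= eqxx.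
apply: (@line_sum_ge0 R Ny by_ (admissible gamma) (Vent gamma) (@mirror_y R) (psiG gamma)
  (phi gamma) (@By R) Gh (fun j => Wt t i j i1 0%N) (fun j => Wt t i j i1 k.+1)
  (fun j => nbB k Ny by_ (Wt t) i j i1) (fun j => nbT k Ny by_ (Wt t) i j i1)) => //.
- exact: esG.2.
- exact: mirror_yK.
- exact: dot_mirror_y.
- exact: Vent_mirror_y.
- exact: psiG_mirror_y.
- exact: admissible_mirror_y.
- by move=> j hj; apply: adm.
- by move=> j hj; apply: adm.
- by move=> Ub byE; apply: (cpt.2 Ub byE).
- by move=> j hj; have [_ _] := divf; apply.
Qed.
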